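(* Let $X$ be a finite nonempty ultrametric space. Then the following statements are equivalent. (i) For every finite nonempty ultrametric space $Y$: if $\overline{T}_X\simeq \overline{T}_Y$, then $X$ and $Y$ are weakly similar. (ii) $X\in \tilde{\mathfrak{R}}$, that is, the representing tree $T_X$ has exactly one inner node at each level except the last level.
   Context: An ultrametric on a set $X$ is a function $d\colon X\times X\to[0,\infty)$ with $d(x,y)=d(y,x)$, $d(x,y)=0\Leftrightarrow x=y$, and $d(x,y)\le\max\{d(x,z),d(z,y)\}$ for all $x,y,z\in X$; then $(X,d)$ is an ultrametric space. Its spectrum is $\operatorname{Sp}(X)=\{d(x,y)\colon x,y\in X\}$ and its diameter is $\operatorname{diam} X=\sup\{d(x,y)\colon x,y\in X\}$. Weak similarity: for $(X,d)$ and $(Y,\rho)$, a bijection $\Phi\colon X\to Y$ is a weak similarity if there is a strictly increasing bijection $f\colon \operatorname{Sp}(X)\to\operatorname{Sp}(Y)$ with $f(d(x,y))=\rho(\Phi(x),\Phi(y))$ for all $x,y\in X$. The spaces $X$ and $Y$ are weakly similar if a weak similarity $\Phi\colon X\to Y$ exists. Representing tree: for a finite nonempty ultrametric space $(X,d)$, the labeled rooted tree $T_X$ is built as follows. If $X$ is a one-point set, $T_X$ consists of the single node $X$ labeled $0$. If $|X|\ge 2$, let $G_X^d$ be the graph with vertex set $X$ in which $u,v$ are adjacent iff $d(u,v)=\operatorname{diam}X$; this graph is complete multipartite, with parts $X_1,\dots,X_k$, $k\ge2$ (equivalently, the parts are the classes of the equivalence relation $d(u,v)<\operatorname{diam}X$).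 The root of $T_X$ is $X$, labeled $\operatorname{diam}X$, and the nodes of the first level (children of the root) are $X_1,\dots,X_k$, labeled $\operatorname{diam}X_i$. Nodes labeled $0$ are leaves; nodes with positive label are inner nodes, and the procedure is repeated with each inner node $X_i$ in place of $X$, and so on until all nodes obtained are leaves. $\overline{T}_X$ denotes the rooted tree $T_X$ without labels. The level of a node is its distance from the root; the last level is the largest level occurring in the tree. For rooted trees, $T_1\simeq T_2$ means there is a bijection of vertex sets preserving adjacency in both directions and mapping the root of $T_1$ to the root of $T_2$. $\tilde{\mathfrak R}$ is the class of finite ultrametric spaces $X$ for which $T_X$ has exactly one inner node at each level except the last level. *)

(* Defs.v *)
From HB Require Import structures.
From mathcomp Require Import all_boot all_order all_algebra.
From mathcomp Require Import all_classical reals.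
Set Implicit Arguments.
Unset Strict Implicit.
Unset Printing Implicit Defensive.
Import Order.TTheory GRing.Theory Num.Theory.
Local Open Scope ring_scope.

Section Ultrametric.
Variables (R : realType) (X : finType) (d : X -> X -> R).

Record is_ultrametric : Prop := IsUltrametric {
  um_ge0 : forall x y, 0 <= d x y;
  um_sym : forall x y, d x y = d y x;
  um_eq0 : forall x y, d x y = 0 <-> x = y;
  um_max : forall x y z, d x y <= Num.max (d x z) (d z y)
}.

(* The spectrum and diameter of the subspace B; those of the whole space are
   Sp [set: X] and diam [set: X]. *)
Definition Sp (B : {set X}) : set R :=
  [set d x y | x in [set` B] & y in [set` B]]%classic.

Definition diam (B : {set X}) : R := sup (Sp B).

End Ultrametric.

Definition weak_similarity (R : realType) (X Y : finType)
    (d : X -> X -> R) (rho : Y -> Y -> R) (Phi : X -> Y) : Prop :=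
  bijective Phi /\
  exists f : R -> R,
    [/\ set_bij (Sp d [set: X]%SET) (Sp rho [set: Y]%SET) f,
        (forall s t, Sp d [set: X]%SET s -> Sp d [set: X]%SET t ->
           s < t -> f s < f t) &
        forall x y, f (d x y) = rho (Phi x) (Phi y)].

Definition weakly_similar (R : realType) (X Y : finType)
    (d : X -> X -> R) (rho : Y -> Y -> R) : Prop :=
  exists Phi : X -> Y, weak_similarity d rho Phi.

Record rooted_graph := RootedGraph {
  vertex : finType;
  adj : rel vertex;
  root : vertex
}.

Definition rooted_iso (T1 T2 : rooted_graph) : Prop :=
  exists phi : vertex T1 -> vertex T2,
    [/\ bijective phi,
        (forall u v, adj (phi u) (phi v) = adj u v) &
        phi (root T1) = root T2].

(* In a connected graph some shortest walk between two vertices has fewer than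
   #|V| edges; for disconnected x and y the value is #|V|. *)
Definition graph_dist (V : finType) (e : rel V) (x y : V) : nat :=
  find (fun n => [exists p : n.-tuple V, path e x p && (last x p == y)])
       (iota 0 #|V|).

Definition level (T : rooted_graph) (v : vertex T) : nat :=
  graph_dist (@adj T) (root T) v.

Definition last_level (T : rooted_graph) : nat :=
  (\max_(v : vertex T) level v)%N.

Section RepresentingTree.
Variables (R : realType) (X : finType) (d : X -> X -> R).

(* Adjacency in the graph G_B^d on the vertex set B. *)
Definition diam_adj (B : {set X}) : rel X := fun u v => d u v == diam d B.

(* The parts of the complete multipartite graph G_B^d are the classes of
   non-adjacency. *)
Definition children (B : {set X}) : {set {set X}} :=
  if 0 < diam d B
  then equivalence_partition (fun u v => ~~ diam_adj B u v) B
  else finset.set0.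

Definition nodes : {set {set X}} :=
  [set B | connect (fun A C => C \in children A) [set: X] B]%SET.

Lemma setT_in_nodes : [set: X]%SET \in nodes.
Proof. by rewrite inE connect0. Qed.

Definition node : finType := {B : {set X} | B \in nodes}.

Definition node_label (v : node) : R := diam d (val v).

Definition inner_node (v : node) : bool := 0 < node_label v.

Definition rep_tree : rooted_graph :=
  @RootedGraph node
    (fun u v => (val v \in children (val u)) || (val u \in children (val v)))
    (exist _ [set: X]%SET setT_in_nodes).

Definition in_Rtilde : Prop :=
  forall n : nat, (n < last_level rep_tree)%N ->
    #|[set v : vertex rep_tree | inner_node v & level v == n]%SET| = 1%N.

End RepresentingTree.

(* Main.v *)
(* The nodes of the representing tree are the clusters: nonempty sets B such
   that points of B are closer to each other than to any point outside B.
   The children of a node are the nodes it covers for inclusion, so the tree is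
   determined by the set of clusters, and a tree isomorphism is an inclusion
   isomorphism between the nodes; the singletons being its minimal elements, it
   comes from a bijection of the points.

   If inner nodes are determined by their level, they form a chain, and d x y
   <= d z t for x <> y, z <> t holds exactly when at least as many nodes contain
   x and y as contain z and t.  Such counts are invariant under tree
   isomorphism, which gives a weak similarity.

   Conversely, replacing d x y by a label of the smallest node containing x and
   y, for any labelling that vanishes on singletons and is strictly monotone for
   inclusion, yields an ultrametric with the same clusters.  If two inner nodes
   have the same level, an injective labelling and one depending only on the
   level give different numbers of distances, so the two spaces cannot both be
   weakly similar to X. *)
Require Import Defs.
From mathcomp Require Import all_classical.
From mathcomp Require Import all_boot all_order all_algebra.
From mathcomp Require Import reals.
Set Implicit Arguments.
Unset Strict Implicit.
Unset Printing Implicit Defensive.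
Import Order.TTheory GRing.Theory Num.Theory.
Local Open Scope ring_scope.
Local Open Scope set_scope.

(** * Distances in finite graphs *)

Lemma graph_dist_iso (U V : finType) (e : rel U) (e' : rel V) (phi : U -> V) :
  bijective phi -> (forall u v, e' (phi u) (phi v) = e u v) ->
  forall x y, graph_dist e' (phi x) (phi y) = graph_dist e x y.
Proof.
move=> [psi phiK psiK] phi_adj x y; rewrite /graph_dist.
have -> : #|V| = #|U| by apply: esym; apply: bij_eq_card (Bijective phiK psiK).
apply: eq_find => n; apply/existsP/existsP => -[p /andP[pp lp]].
  exists [tuple of map psi p]; rewrite -(can_eq phiK).
  rewrite -[x in path _ x]phiK -{2}[x]phiK last_map psiK lp andbT path_map.
  by rewrite (eq_path (e' := e')) // => u v /=; rewrite -phi_adj !psiK.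
exists [tuple of map phi p]; rewrite last_map (can_eq phiK) lp andbT path_map.
by rewrite (eq_path (e' := e)) // => u v /=; rewrite phi_adj.
Qed.

(** Since [f] grows by at most one along an edge, every walk from [x] to [y] has at least [f y]
    edges, and [p] attains this bound. The bound [f y < #|V|] puts [f y] in the range that
    [graph_dist] searches. *)
Lemma graph_dist_potential (V : finType) (e : rel V) (f : V -> nat) x y
    (p : seq V) :
  f x = 0%N -> (forall u v, e u v -> (f v <= (f u).+1)%N) ->
  path e x p -> last x p = y -> size p = f y -> (f y < #|V|)%N ->
  graph_dist e x y = f y.
Proof.
move=> fx0 fe pp lp sp fy; rewrite /graph_dist.
set a := (fun n => _).
have afy : a (f y).
  apply/existsP; exists (Tuple (introT eqP sp)) => /=.
  by rewrite pp lp eqxx.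
have aN n : a n -> (f y <= n)%N.
  case/existsP => -[q /= /eqP <-] /andP[qp /eqP <-].
  suff gen r t : path e t r -> (f (last t r) <= f t + size r)%N.
    by have := gen q x qp; rewrite fx0.
  elim: r t => [|s r IHr] t /=; first by rewrite addn0.
  case/andP => /fe ts /IHr h; apply: (leq_trans h).
  by rewrite addnS -addSn leq_add2r.
apply/eqP; rewrite eqn_leq; apply/andP; split.
  rewrite -ltnS; apply: find_ltn.
  apply/(has_nthP 0%N); exists (f y); last first.
    by rewrite nth_take // nth_iota.
  by rewrite size_takel ?size_iota.
have hasa : has a (iota 0 #|V|).
  by apply/(has_nthP 0%N); exists (f y); rewrite ?size_iota ?nth_iota.
have := nth_find 0%N hasa; rewrite nth_iota ?add0n; first exact: aN.
by rewrite -[X in (_ < X)%N](size_iota 0) -has_find.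
Qed.

(** * Clusters and the nodes of the representing tree *)

Section Clusters.
Variables (R : realType) (X : finType) (d : X -> X -> R).
Hypotheses (hd : is_ultrametric d) (hX : (0 < #|X|)%N).

Definition cluster (B : {set X}) : Prop :=
  B != set0 /\ forall x y z, x \in B -> y \in B -> z \notin B -> d x y < d x z.

Definition closed_ball (x : X) (r : R) : {set X} := [set z | d x z <= r].

Lemma dxx x : d x x = 0.
Proof. exact/(um_eq0 hd). Qed.

Lemma d_gt0 x y : (0 < d x y) = (x != y).
Proof.
rewrite lt0r (um_ge0 hd) andbT; congr negb.
by apply/eqP/eqP => /(um_eq0 hd).
Qed.

Lemma diamP (B : {set X}) : B != set0 ->
  (forall x y, x \in B -> y \in B -> d x y <= diam d B) /\
  exists x y, [/\ x \in B, y \in B & diam d B = d x y].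
Proof.
case/set0Pn => b bB.
pose P (p : X * X) := (p.1 \in B) && (p.2 \in B).
have Pbb : P (b, b) by rewrite /P bB.
case: (@arg_maxP _ _ _ (b, b) P (fun p => d p.1 p.2) Pbb) => -[x y].
case/andP => /= xB yB hmax.
have ubd : ubound (Sp d B) (d x y).
  move=> r [u uB [v vB <-]]; apply: (hmax (u, v)).
  by apply/andP; split; [exact: uB|exact: vB].
have Sxy : Sp d B (d x y) by exists x => //; exists y.
have -> : diam d B = d x y.
  apply/eqP; rewrite eq_le ge_sup ?ub_le_sup //; last by exists (d x y).
  by exists (d x y).
split; last by exists x, y.
by move=> u v uB vB; apply: (hmax (u, v)); rewrite /P /= uB vB.
Qed.

Lemma diam_gt0P (B : {set X}) : B != set0 ->
  reflect (exists x y, [/\ x \in B, y \in B & x != y]) (0 < diam d B).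
Proof.
move=> B0; apply: (iffP idP); have [le_diam [x [y [xB yB dB]]]] := diamP B0.
  by rewrite dB d_gt0 => neq; exists x, y.
case=> u [v [uB vB neq]]; apply: lt_le_trans (le_diam u v uB vB).
by rewrite d_gt0.
Qed.

Lemma childrenP (B C : {set X}) :
  reflect (0 < diam d B /\
           exists2 x, x \in B & C = [set y in B | d x y != diam d B])
          (C \in children d B).
Proof.
rewrite /children; case: ltP => _; last first.
  by rewrite inE; constructor => -[].
by apply: (iffP imsetP) => [[x xB ->]|[_ [x xB ->]]];
   [split=> //; exists x | exists x].
Qed.

Lemma cluster_setT : cluster setT.
Proof.
split; last by move=> x y z _ _; rewrite inE.
by rewrite -card_gt0 cardsT.
Qed.

(** A child is the trace on [B] of an open ball of radius [diam d B]. By the ultrametric inequality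
    its points are at mutual distance below that radius, while points of [B] outside it are at least
    that far away. The inclusion is strict because the diameter of [B] is attained. *)
Lemma cluster_child (B C : {set X}) :
  cluster B -> C \in children d B -> cluster C /\ C \proper B.
Proof.
move=> [B0 clB] /childrenP[dB [x xB ->]].
have [le_diam [a [b [aB bB dab]]]] := diamP B0.
set K := [set y in B | _].
have KE y : y \in K = (y \in B) && (d x y < diam d B).
  rewrite inE; case: (boolP (y \in B)) => //= yB.
  by rewrite lt_neqAle le_diam // andbT.
have xK : x \in K by rewrite KE xB dxx dB.
have dK u v : u \in K -> v \in K -> d u v < diam d B.
  rewrite !KE => /andP[uB ux] /andP[vB vx].
  apply: le_lt_trans (um_max hd u v x) _.
  by rewrite gt_max (um_sym hd u) ux vx.
split; first split.
- by apply/set0Pn; exists x.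
- move=> u v w uK vK wK.
  have uB : u \in B by move: uK; rewrite KE => /andP[].
  have vB : v \in B by move: vK; rewrite KE => /andP[].
  have [wB|wB] := boolP (w \in B); last exact: clB.
  apply: (lt_le_trans (dK u v uK vK)).
  rewrite leNgt; apply: contra wK => uw; rewrite KE wB /=.
  apply: le_lt_trans (um_max hd x w u) _.
  by rewrite gt_max uw andbT dK.
- rewrite properE; apply/andP; split.
    by apply/subsetP => y; rewrite KE => /andP[].
  apply/negP => /subsetP sBK.
  by have := dK a b (sBK a aB) (sBK b bB); rewrite dab ltxx.
Qed.

Lemma node_ind (P : {set X} -> Prop) :
  P setT -> (forall B C, B \in nodes d -> P B -> C \in children d B -> P C) ->
  forall B, B \in nodes d -> P B.
Proof.
move=> PT PC B; rewrite inE => /connectP[p].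
elim/last_ind: p B => [|p C IH] B /=; first by move=> _ ->.
rewrite rcons_path last_rcons => /andP[pp lp] ->.
apply: PC lp; last exact: IH.
by rewrite inE; apply/connectP; exists p.
Qed.

Lemma child_node (B C : {set X}) :
  B \in nodes d -> C \in children d B -> C \in nodes d.
Proof.
rewrite !inE => BN CB; apply: connect_trans BN _; exact: connect1.
Qed.

Lemma node_cluster (B : {set X}) : B \in nodes d -> cluster B.
Proof.
move: B; apply: node_ind; first exact: cluster_setT.
by move=> B C _ clB /(cluster_child clB)[].
Qed.

(** A point [z] of [B] outside [C] is farther from [x] than every point of [C], so no point of [C]
    is at distance [diam d B] from [x]: the class of [x] contains [C]. *)
Lemma subset_child (B C : {set X}) :
  cluster B -> cluster C -> C \proper B ->
  exists2 K, K \in children d B & C \subset K.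
Proof.
move=> [B0 clB] [/set0Pn[x xC] clC] /properP[sCB [z zB zC]].
have [le_diam _] := diamP B0.
have xB := subsetP sCB x xC.
exists [set y in B | d x y != diam d B].
  apply/childrenP; split; last by exists x.
  apply/(diam_gt0P B0); exists x, z; split => //.
  by apply: contraNneq zC => <-.
apply/subsetP => y yC; rewrite inE (subsetP sCB) //= lt_eqF //.
exact: lt_le_trans (clC x y z xC yC zC) (le_diam _ _ xB zB).
Qed.

(** Descent from the root: while the current node strictly contains [C], one of its children still
    contains [C], and cardinality drops. *)
Lemma cluster_node (C : {set X}) : cluster C -> C \in nodes d.
Proof.
move=> clC.
suff gen n (B : {set X}) : (#|B| <= n)%N -> B \in nodes d -> C \subset B ->
    C \in nodes d by apply: (gen _ _ (leqnn _) (setT_in_nodes d)); rewrite subsetT.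
elim: n B => [|n IH] B leB BN sCB.
  have [B0 _] := node_cluster BN.
  by move: leB; rewrite leqn0 cards_eq0 (negbTE B0).
have [<-|neq] := eqVneq B C; first by [].
have pCB : C \proper B by rewrite properEneq eq_sym neq.
have [K KB sCK] := subset_child (node_cluster BN) clC pCB.
apply: (IH K _ (child_node BN KB) sCK); rewrite -ltnS.
apply: leq_trans leB; apply: proper_card.
by case: (cluster_child (node_cluster BN) KB).
Qed.

(** Points [y] of [B] outside [C] and [z] of [C] outside [B] would give both [d x y < d x z] and
    [d x z < d x y]. *)
Lemma cluster_laminar (B C : {set X}) x :
  cluster B -> cluster C -> x \in B -> x \in C -> (B \subset C) || (C \subset B).
Proof.
move=> [_ clB] [_ clC] xB xC; apply/orP.
have [|/subsetPn[y yB yC]] := boolP (B \subset C); first by left.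
right; apply/subsetP => z zC; apply: contraT => zB.
have := lt_trans (clB x y z xB yB zB) (clC x z y xC zC yC).
by rewrite ltxx.
Qed.

(** Frees the child relation from the distance: it depends only on the set of nodes and on
    inclusion, so two ultrametrics with the same nodes have the same tree. *)
Lemma child_cover (B C : {set X}) : B \in nodes d ->
  (C \in children d B) =
  [&& C \in nodes d, C \proper B &
      [forall D in nodes d, (C \proper D) ==> (B \subset D)]].
Proof.
move=> BN; have clB := node_cluster BN.
apply/idP/and3P => [CB|[CN pCB /forall_inP cov]]; last first.
  have [K KB sCK] := subset_child clB (node_cluster CN) pCB.
  have [eqCK|neq] := eqVneq C K; first by rewrite eqCK.
  have pCK : C \proper K by rewrite properEneq neq.
  have sBK := implyP (cov K (child_node BN KB)) pCK.
  have [_] := cluster_child clB KB; rewrite properE.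
  by rewrite sBK andbF.
have [clC pCB] := cluster_child clB CB; have CN := child_node BN CB.
split => //; apply/forall_inP => D DN; apply/implyP => pCD.
have clD := node_cluster DN; have [C0 _] := clC; case/set0Pn: C0 => x xC.
have xD := subsetP (proper_sub pCD) x xC.
have xB := subsetP (proper_sub pCB) x xC.
case/orP: (cluster_laminar clB clD xB xD) => // sDB; apply: contraT => nsBD.
have pDB : D \proper B by rewrite properE sDB.
have [K KB sDK] := subset_child clB clD pDB.
(* A node [D] strictly between [C] and [B] would lie in a child [K]. The children are equivalence
   classes, and [C] and [K] share [x], so they coincide. *)
suff eqCK : C = K.
  by move: pCD; rewrite properE eqCK sDK andbF.
have xK := subsetP sDK x xD.
case/childrenP: CB => _ [c cB Cc]; case/childrenP: KB => _ [k kB Kk].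
have [B0 _] := clB; have [le_diam _] := diamP B0.
have ltd u y : u \in B -> y \in B -> d u y != diam d B -> d u y < diam d B.
  by move=> uB yB h; rewrite lt_neqAle h le_diam.
have eqv u : u \in B -> d u x != diam d B ->
    [set y in B | d u y != diam d B] = [set y in B | d x y != diam d B].
  move=> uB /(ltd _ _ uB xB) ux; apply/setP => y; rewrite !inE.
  case: (boolP (y \in B)) => //= yB; apply/idP/idP => h; rewrite lt_eqF //.
    apply: le_lt_trans (um_max hd x y u) _.
    by rewrite gt_max (um_sym hd x) ux ltd.
  apply: le_lt_trans (um_max hd u y x) _.
  by rewrite gt_max ux ltd.
rewrite Cc Kk (eqv c) ?(eqv k) //.
  by move: xK; rewrite Kk inE => /andP[].
by move: xC; rewrite Cc inE => /andP[].
Qed.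

(** * Closed balls as the smallest nodes containing two points *)

Lemma cluster_ball x y : cluster (closed_ball x (d x y)).
Proof.
split; first by apply/set0Pn; exists x; rewrite inE dxx (um_ge0 hd).
move=> u v w; rewrite !inE -ltNge => ux vx xw.
have uv : d u v <= d x y.
  by apply: le_trans (um_max hd u v x) _; rewrite ge_max (um_sym hd u) ux vx.
apply: le_lt_trans uv _; apply: (lt_le_trans xw).
have := um_max hd x w u; rewrite le_max => /orP[] // xwu.
by have := lt_le_trans xw (le_trans xwu ux); rewrite ltxx.
Qed.

Lemma ball_node x y : closed_ball x (d x y) \in nodes d.
Proof. exact/cluster_node/cluster_ball. Qed.

Lemma mem_ball x y : (x \in closed_ball x (d x y)) * (y \in closed_ball x (d x y)).
Proof. by rewrite !inE dxx (um_ge0 hd) lexx. Qed.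

Lemma set1_node x : [set x] \in nodes d.
Proof.
apply: cluster_node; split; first by apply/set0Pn; exists x; rewrite inE.
move=> u v w; rewrite !inE => /eqP -> /eqP -> neq.
by rewrite dxx d_gt0 eq_sym.
Qed.

Lemma ball_min x y (B : {set X}) :
  B \in nodes d -> (closed_ball x (d x y) \subset B) = (x \in B) && (y \in B).
Proof.
move=> /node_cluster[_ clB]; apply/idP/andP => [/subsetP s|[xB yB]].
  by split; apply: s; rewrite mem_ball.
apply/subsetP => z; rewrite inE; apply: contraTT => zB.
by rewrite -ltNge; apply: clB.
Qed.

Lemma diam_ball x y : diam d (closed_ball x (d x y)) = d x y.
Proof.
have [B0 _] := cluster_ball x y; have [le_diam [u [v [uB vB dB]]]] := diamP B0.
apply/eqP; rewrite eq_le le_diam ?mem_ball // andbT dB.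
move: uB vB; rewrite !inE => ux vx.
by apply: le_trans (um_max hd u v x) _; rewrite ge_max (um_sym hd u) ux vx.
Qed.

(** * Levels read off from inclusion *)

Definition to_node (B : {set X}) (BN : B \in nodes d) : node d := exist _ B BN.

Definition depth (B : {set X}) : nat :=
  #|[set u : node d | B \proper val u]|.

Lemma depth_setT : depth setT = 0%N.
Proof.
apply/eqP; rewrite cards_eq0; apply/eqP/setP => u; rewrite !inE.
by rewrite properE subsetT; case: (boolP (_ \subset _)).
Qed.

(** By [child_cover], the nodes strictly above [C] are [B] and the nodes strictly above [B]. *)
Lemma depth_child (B C : {set X}) :
  B \in nodes d -> C \in children d B -> depth C = (depth B).+1.
Proof.
move=> BN CB; move: (CB); rewrite child_cover // => /and3P[CN pCB /forall_inP cov].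
rewrite /depth (_ : [set u | C \proper _] =
  to_node BN |: [set u : node d | B \proper val u]).
  by rewrite cardsU1 inE /= properxx.
apply/setP => u; rewrite !inE -val_eqE /=; apply/idP/orP => [pCu|[/eqP->|]] //.
  have := implyP (cov _ (valP u)) pCu; rewrite subEproper => /orP[/eqP <-|->].
    by left.
  by right.
exact: proper_trans.
Qed.

Lemma depth_proper (B C : {set X}) : C \in nodes d -> B \proper C ->
  (depth C < depth B)%N.
Proof.
move=> CN pBC; apply: proper_card; apply/properP; split.
  by apply/subsetP => u; rewrite !inE; apply: proper_trans.
by exists (to_node CN); rewrite inE //= properxx.
Qed.

Lemma depth_lt_card (v : node d) : (depth (val v) < #|node d|)%N.
Proof.
rewrite -cardsT; apply: proper_card; apply/properP; split; first exact: subsetT.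
by exists v; rewrite inE // properxx.
Qed.

Lemma ancestor (B : {set X}) n : B \in nodes d -> (n < depth B)%N ->
  exists C, [/\ C \in nodes d, B \proper C & depth C = n].
Proof.
move=> BN; move: B BN n; apply: node_ind => [n|B C BN IH CB n].
  by rewrite depth_setT.
have [_ pCB] := cluster_child (node_cluster BN) CB.
rewrite (depth_child BN CB) ltnS leq_eqVlt => /orP[/eqP ->|/IH].
  by exists B.
by case=> D [DN pBD dD]; exists D; split=> //; apply: proper_trans pBD.
Qed.

(** [depth] serves as a potential: it changes by one along each edge, and the descent from the root
    to [v] has exactly [depth (val v)] edges. *)
Lemma level_depth (v : vertex (rep_tree d)) : level v = depth (val v).
Proof.
pose f (u : vertex (rep_tree d)) := depth (val u).
have [p pp [lp sp]] : exists2 p, path (@adj (rep_tree d)) (Defs.root (rep_tree d)) p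
    & last (Defs.root (rep_tree d)) p = v /\ size p = depth (val v).
  case: v => B BN /=.
  suff: forall BN : B \in nodes d, exists2 p,
    path (@adj (rep_tree d)) (Defs.root (rep_tree d)) p
    & last (Defs.root (rep_tree d)) p = exist _ B BN /\ size p = depth B by apply.
  move: B {BN} (BN : B \in nodes d); apply: node_ind.
    by move=> TN; exists [::] => //; split; [apply: val_inj|rewrite depth_setT].
  move=> B C BN /(_ BN)[p pp [lp sp]] CB CN; exists (rcons p (exist _ C CN)).
    by rewrite rcons_path pp lp /= CB.
  by rewrite last_rcons size_rcons sp (depth_child BN CB).
apply: (graph_dist_potential (f := f) (p := p)) => //.
- exact: depth_setT.
- move=> u w /orP[] h; first by rewrite /f (depth_child (valP u) h).
  by rewrite /f (depth_child (valP w) h) -addn2 leq_addr.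
- exact: depth_lt_card.
Qed.

(** * Inner nodes and the class of spaces with one inner node per level *)

Lemma inner_nodeP (v : node d) :
  reflect (exists u : node d, val u \proper val v) (inner_node v).
Proof.
have clv := node_cluster (valP v); have [v0 _] := clv.
apply: (iffP (diam_gt0P v0)) => [[x [y [xv yv neq]]]|[u /properP[suv [y yv yu]]]].
  exists (to_node (set1_node x)); apply/properP; split => /=.
    by rewrite sub1set.
  by exists y => //; rewrite inE eq_sym.
have [/set0Pn[x xu] _] := node_cluster (valP u).
by exists x, y; split => //; [exact: (subsetP suv)|apply: contraNneq yu => <-].
Qed.

Lemma inner_ballP (v : node d) : inner_node v ->
  exists x y, x != y /\ val v = closed_ball x (d x y).
Proof.
have [v0 clv] := node_cluster (valP v).
rewrite /inner_node /node_label; have [le_diam [x [y [xv yv dv]]]] := diamP v0.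
rewrite dv d_gt0 => neq; exists x, y; split=> //.
apply/eqP; rewrite eqEsubset; apply/andP; split; last first.
  by rewrite ball_min ?xv ?yv //; exact: (valP v).
by apply/subsetP => z zv; rewrite inE -dv le_diam.
Qed.

(** Existence is automatic: a node at the last level has an ancestor at every smaller level, and
    that ancestor is inner. The last level itself has no inner node, since an inner node has a
    deeper node below it. Only uniqueness remains. *)
Lemma in_RtildeP :
  in_Rtilde d <-> forall u v : node d, inner_node u -> inner_node v ->
    depth (val u) = depth (val v) -> u = v.
Proof.
split=> [h u v iu iv duv|h n lt_n].
  have lt_u : (level (u : vertex (rep_tree d)) < last_level (rep_tree d))%N.
    have [w pwu] := inner_nodeP u iu.
    have lt := depth_proper (valP u) pwu.
    rewrite level_depth; apply: (leq_trans lt); rewrite -level_depth.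
    exact: (leq_bigmax (w : vertex (rep_tree d))).
  have /eqP/cards1P[w Ew] := h _ lt_u.
  have: u \in [set w] by rewrite -Ew inE iu eqxx.
  have: v \in [set w] by rewrite -Ew inE iv !level_depth duv eqxx.
  by rewrite !inE => /eqP -> /eqP ->.
have [v Ev] : exists v : vertex (rep_tree d), last_level (rep_tree d) = level v.
  rewrite /last_level; case: (@bigop.eq_bigmax _ (@level (rep_tree d))).
    by apply/card_gt0P; exists (Defs.root (rep_tree d)).
  by move=> v ->; exists v.
move: lt_n; rewrite Ev level_depth => /(ancestor (valP v))[C [CN pvC dC]].
pose u := to_node CN.
have iu : inner_node u by apply/inner_nodeP; exists v.
apply/eqP/cards1P; exists u; apply/setP => w; rewrite !inE level_depth.
apply/andP/eqP => [[iw /eqP dw]|->]; last by rewrite iu dC.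
by apply: h => //; rewrite dw dC.
Qed.

Definition common_nodes (x y : X) : nat :=
  #|[set u : node d | (x \in val u) && (y \in val u)]|.

Lemma common_nodesE x y : common_nodes x y = (depth (closed_ball x (d x y))).+1.
Proof.
pose b := to_node (ball_node x y).
rewrite /common_nodes (_ : [set u | _] =
  b |: [set u : node d | val b \proper val u]); last first.
  apply/setP => u; rewrite !inE -val_eqE -ball_min ?(valP u) //.
  by rewrite subEproper eq_sym.
by rewrite cardsU1 inE properxx.
Qed.

Lemma inner_ball x y : x != y -> inner_node (to_node (ball_node x y)).
Proof. by move=> neq; rewrite /inner_node /node_label /= diam_ball d_gt0. Qed.

(** If the ball of [u], [v] is less deep than that of [a], [b], the latter has an inner ancestor at
    the depth of the former. Uniqueness identifies the two, so one ball lies strictly inside the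
    other and its diameter is smaller. *)
Lemma le_dist_common_nodes x y z t : in_Rtilde d -> x != y -> z != t ->
  (d x y <= d z t) = (common_nodes z t <= common_nodes x y)%N.
Proof.
move/in_RtildeP => inj_depth nxy nzt; rewrite !common_nodesE ltnS.
have lt_main a b u v : a != b -> u != v ->
  (depth (closed_ball u (d u v)) < depth (closed_ball a (d a b)))%N ->
  d a b < d u v.
  move=> nab nuv /(ancestor (ball_node a b))[C [CN pC dC]].
  have iC : inner_node (to_node CN).
    by apply/inner_nodeP; exists (to_node (ball_node a b)).
  have /(congr1 val) /= eqC := inj_depth _ _ iC (inner_ball nuv) dC.
  rewrite -(diam_ball u v) -eqC; case/properP: pC => sC [w wC].
  rewrite inE -ltNge => aw; apply: (lt_le_trans aw).
  have [C0 _] := node_cluster CN; have [le_diam _] := diamP C0.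
  by apply: le_diam => //; apply: (subsetP sC); rewrite mem_ball.
case: (ltngtP (depth _) (depth _)) =>
  [/(lt_main _ _ _ _ nxy nzt) lt|/(lt_main _ _ _ _ nzt nxy) lt|eqd].
- by rewrite ltW.
- by rewrite leNgt lt.
- have := inj_depth _ _ (inner_ball nzt) (inner_ball nxy) eqd.
  move/(congr1 (fun u : node d => diam d (val u))); rewrite /= !diam_ball => ->.
  by rewrite lexx.
Qed.

(** Adjacency is symmetric; levels recover which end of an edge is the parent, in terms that a
    rooted isomorphism preserves. *)
Lemma child_adj (u v : vertex (rep_tree d)) :
  (val v \in children d (val u)) = adj u v && (level v == (level u).+1).
Proof.
apply/idP/andP => [vu|[/orP[] // uv]].
  by rewrite /= vu !level_depth (depth_child (valP u) vu).
rewrite !level_depth (depth_child (valP v) uv).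
by rewrite eqn_leq [X in _ && X]ltnNge leqnSn andbF.
Qed.

End Clusters.

(** * Rooted tree isomorphisms preserve inclusion *)

Section TreeIsomorphism.
Variables (R : realType) (X Y : finType) (d : X -> X -> R) (rho : Y -> Y -> R).
Hypotheses (hd : is_ultrametric d) (hX : (0 < #|X|)%N).
Hypotheses (hrho : is_ultrametric rho) (hY : (0 < #|Y|)%N).
Variables (phi : vertex (rep_tree d) -> vertex (rep_tree rho)).
Hypotheses (phi_bij : bijective phi)
  (phi_adj : forall u v, adj (phi u) (phi v) = adj u v)
  (phi_root : phi (Defs.root (rep_tree d)) = Defs.root (rep_tree rho)).

Lemma iso_level v : level (phi v) = level v.
Proof. by rewrite /level -phi_root; apply: graph_dist_iso. Qed.

Lemma iso_depth (u : node d) : depth rho (val (phi u)) = depth d (val u).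
Proof.
rewrite -(level_depth hd hX u) -iso_level; apply: esym; exact: level_depth.
Qed.

(** Induction down from the root: a node strictly above [C] contains the parent of [C], and parents
    go to parents because adjacency and levels are preserved. *)
Lemma iso_subset (u v : node d) :
  val u \subset val v -> val (phi u) \subset val (phi v).
Proof.
suff gen B : B \in nodes d -> forall BN : B \in nodes d,
    B \subset val v -> val (phi (to_node BN)) \subset val (phi v).
  by case: u => B BN; apply: gen.
move: B; apply: node_ind => [TN|B C BN IH CB CN] sv.
  have -> : v = to_node TN by apply/val_inj/eqP; rewrite /= -subTset.
  exact: subxx.
have [eqCv|neq] := eqVneq C (val v).
  by have -> : v = to_node CN by apply: val_inj.
have pCv : C \proper val v by rewrite properEneq neq.
have := CB; rewrite (child_cover hd hX) // => /and3P[_ _ /forall_inP cov].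
apply: subset_trans (IH BN (implyP (cov _ (valP v)) pCv)).
have: val (phi (to_node CN)) \in children rho (val (phi (to_node BN))).
  rewrite (child_adj hrho hY) phi_adj !iso_level -(child_adj hd hX); exact: CB.
case/(cluster_child hrho (node_cluster hrho hY (valP _))) => _.
exact: proper_sub.
Qed.

End TreeIsomorphism.

(** * From inclusion isomorphisms of nodes to maps of points *)

Section OrderIsomorphism.
Variables (R : realType) (X Y : finType) (d : X -> X -> R) (rho : Y -> Y -> R).
Hypotheses (hd : is_ultrametric d) (hX : (0 < #|X|)%N).
Hypotheses (hrho : is_ultrametric rho) (hY : (0 < #|Y|)%N).
Variables (phi : node d -> node rho) (psi : node rho -> node d).
Hypotheses (phiK : cancel phi psi) (psiK : cancel psi phi).
Hypothesis phi_sub :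
  forall u v, (val (phi u) \subset val (phi v)) = (val u \subset val v).

Lemma iso_points :
  exists Phi : X -> Y, forall x v, (Phi x \in val (phi v)) = (x \in val v).
Proof.
pose leafX x := to_node (set1_node hd hX x).
pose leafY y := to_node (set1_node hrho hY y).
suff /fin_all_exists[Phi PhiP] : forall x, exists y, phi (leafX x) = leafY y.
  by exists Phi => x v; rewrite -!sub1set -[[set x]]/(val (leafX x)) -phi_sub PhiP.
move=> x; have [/set0Pn[y yx] _] := node_cluster hrho hY (valP (phi (leafX x))).
(* The leaf of [y] lies in the image of the leaf of [x]; pulled back by [psi] it is a nonempty
   subset of [[set x]], hence all of it. *)
exists y; rewrite -[leafY y]psiK; congr phi; apply: val_inj; apply/esym/eqP.
have: val (leafY y) \subset val (phi (leafX x)) by rewrite sub1set.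
rewrite -[leafY y]psiK phi_sub subset1.
have [/negbTE -> _] := node_cluster hd hX (valP (psi (leafY y))).
by rewrite orbF phiK.
Qed.

Lemma iso_inner v : inner_node (phi v) = inner_node v.
Proof.
apply/(inner_nodeP hrho hY)/(inner_nodeP hd hX) => -[u]; rewrite properE.
  by rewrite -[u]psiK !phi_sub; exists (psi u); rewrite properE.
by rewrite -!phi_sub; exists (phi u); rewrite properE.
Qed.

Lemma iso_common_nodes (Phi : X -> Y) :
  (forall x v, (Phi x \in val (phi v)) = (x \in val v)) ->
  forall x y, common_nodes rho (Phi x) (Phi y) = common_nodes d x y.
Proof.
move=> PhiP x y; have phi_inj := can_inj phiK.
rewrite /common_nodes -[RHS](card_imset _ phi_inj); congr #|pred_of_set _|.
by apply/setP => v; rewrite -[v]psiK mem_imset // !inE !PhiP.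
Qed.

End OrderIsomorphism.

(** * Weak similarity from comparison of distances *)

Lemma weakly_similar_mono (R : realType) (X Y : finType)
    (d : X -> X -> R) (rho : Y -> Y -> R) (Phi : X -> Y) :
  bijective Phi ->
  (forall x y z t,
    (rho (Phi x) (Phi y) <= rho (Phi z) (Phi t)) = (d x y <= d z t)) ->
  weakly_similar d rho.
Proof.
move=> Phi_bij mono; exists Phi; split => //.
(* Any pair at distance [r] may be picked, since [mono] makes the value independent of the choice; 0
   is a default outside the spectrum. *)
pose f r := if [pick p | d p.1 p.2 == r] is Some p
            then rho (Phi p.1) (Phi p.2) else 0.
have fE x y : f (d x y) = rho (Phi x) (Phi y).
  rewrite /f; case: pickP => [[z t] /= /eqP dzt|/(_ (x, y))]; last by rewrite eqxx.
  by apply/eqP; rewrite eq_le !mono dzt lexx.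
have f_mono s t : Sp d setT s -> Sp d setT t -> (f s <= f t) = (s <= t).
  by case=> x _ [y _ <-] [z _ [w _ <-]]; rewrite !fE mono.
exists f; split => //; last by move=> s t Ss St; rewrite !ltNge f_mono.
split.
- move=> r [x _ [y _ <-]]; exists (Phi x); first exact: in_setT.
  by exists (Phi y); [exact: in_setT|].
- move=> s t /set_mem Ss /set_mem St eqf.
  by apply/eqP; rewrite eq_le -(f_mono s) // -(f_mono t) // eqf lexx.
- have [Psi PhiK PsiK] := Phi_bij.
  move=> r [x _ [y _ <-]]; exists (d (Psi x) (Psi y)); last by rewrite fE !PsiK.
  exists (Psi x); first exact: in_setT.
  by exists (Psi y); [exact: in_setT|].
Qed.

Lemma Rtilde_weakly_similar (R : realType) (X Y : finType)
    (d : X -> X -> R) (rho : Y -> Y -> R) :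
  is_ultrametric d -> (0 < #|X|)%N -> is_ultrametric rho -> (0 < #|Y|)%N ->
  in_Rtilde d -> rooted_iso (rep_tree d) (rep_tree rho) -> weakly_similar d rho.
Proof.
move=> hd hX hrho hY RX [phi [phi_bij phi_adj phi_root]].
have [psi phiK psiK] := phi_bij.
have psi_bij : bijective psi by exists phi.
have psi_adj u v : adj (psi u) (psi v) = adj u v by rewrite -phi_adj !psiK.
have psi_root : psi (Defs.root (rep_tree rho)) = Defs.root (rep_tree d).
  by rewrite -phi_root phiK.
have phi_sub u v : (val (phi u) \subset val (phi v)) = (val u \subset val v).
  apply/idP/idP; last exact: iso_subset.
  by rewrite -{2}[u]phiK -{2}[v]phiK; apply: iso_subset.
have psi_sub u v : (val (psi u) \subset val (psi v)) = (val u \subset val v).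
  by rewrite -phi_sub !psiK.
have [Phi PhiP] := iso_points hd hX hrho hY phiK psiK phi_sub.
have [Psi PsiP] := iso_points hrho hY hd hX psiK phiK psi_sub.
have PhiK : cancel Phi Psi.
  move=> x; apply/eqP; rewrite -in_set1.
  rewrite -[[set x]]/(val (to_node (set1_node hd hX x))).
  by rewrite -[to_node _]phiK PsiP PhiP /= inE.
have PsiK : cancel Psi Phi.
  move=> y; apply/eqP; rewrite -in_set1.
  rewrite -[[set y]]/(val (to_node (set1_node hrho hY y))).
  by rewrite -[to_node _]psiK PhiP PsiP /= inE.
(* Counting common nodes orders the distances of [Y] only if [Y] is in the class too, which follows
   as inner nodes and depths are preserved. *)
have RY : in_Rtilde rho.
  apply/(in_RtildeP hrho hY) => u v.
  rewrite -[u]psiK -[v]psiK !(iso_inner hd hX hrho hY psiK phi_sub) => iu iv.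
  rewrite !(iso_depth hd hX hrho hY phi_bij phi_adj phi_root) => duv.
  by congr phi; apply: (in_RtildeP hd hX).1.
apply: (@weakly_similar_mono _ _ _ _ _ Phi) => [|x y z t]; first by exists Psi.
(* Zero distances are treated apart: leaves may have different depths, so counting common nodes
   compares only positive distances. *)
have [->|nxy] := eqVneq x y.
  by rewrite (dxx hd) (dxx hrho) (um_ge0 hd) (um_ge0 hrho).
have nPxy : Phi x != Phi y by rewrite (can_eq PhiK).
have [->|nzt] := eqVneq z t.
  by rewrite (dxx hd) (dxx hrho) !leNgt (d_gt0 hd) (d_gt0 hrho) nxy nPxy.
have nPzt : Phi z != Phi t by rewrite (can_eq PhiK).
rewrite (le_dist_common_nodes hd hX) // (le_dist_common_nodes hrho hY) //.
by rewrite !(iso_common_nodes phiK psiK PhiP).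
Qed.

(** * Relabelling the nodes without changing the tree *)

Section Relabelling.
Variables (R : realType) (X : finType) (d : X -> X -> R).
Hypotheses (hd : is_ultrametric d) (hX : (0 < #|X|)%N).
Variable ell : {set X} -> R.
Hypothesis ell_set1 : forall x, ell [set x] = 0.
Hypothesis ell_mono : forall B C,
  B \in nodes d -> C \in nodes d -> B \proper C -> ell B < ell C.

Definition relabel (x y : X) : R := ell (closed_ball d x (d x y)).

Lemma closed_ball_sym x y : closed_ball d x (d x y) = closed_ball d y (d y x).
Proof.
by apply/eqP; rewrite eqEsubset !ball_min ?ball_node // !(mem_ball hd).
Qed.

Lemma relabel_sym x y : relabel x y = relabel y x.
Proof. by rewrite /relabel closed_ball_sym. Qed.

Lemma ell_homo B C : B \in nodes d -> C \in nodes d -> B \subset C -> ell B <= ell C.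
Proof.
move=> BN CN; rewrite subEproper => /orP[/eqP->|/ell_mono h]; first exact: lexx.
by rewrite ltW ?h.
Qed.

Lemma relabel_le x y z : d x y <= d x z -> relabel x y <= relabel x z.
Proof.
move=> le_d; apply: ell_homo; rewrite ?ball_node //.
by apply/subsetP => w; rewrite !inE => /le_trans->.
Qed.

Lemma relabel_lt x y z : d x y < d x z -> relabel x y < relabel x z.
Proof.
move=> lt_d; apply: ell_mono; rewrite ?ball_node //; apply/properP; split.
  by apply/subsetP => w; rewrite !inE => /le_trans->//; rewrite ltW.
by exists z; rewrite inE ?lexx // -ltNge.
Qed.

(** Balls around the common point [x] are nested, so a monotone label keeps their order. Clusters
    involve only such comparisons, hence they survive relabelling. *)
Lemma relabel_ltE x y z : (relabel x y < relabel x z) = (d x y < d x z).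
Proof.
apply/idP/idP; last exact: relabel_lt.
by rewrite !ltNge; apply: contra; apply: relabel_le.
Qed.

Lemma relabel_xx x : relabel x x = 0.
Proof.
rewrite /relabel (_ : closed_ball d x _ = [set x]) //; apply/setP => y.
by rewrite !inE (dxx hd) leNgt (d_gt0 hd) negbK eq_sym.
Qed.

Lemma relabel_ultrametric : is_ultrametric relabel.
Proof.
split.
- move=> x y; rewrite -(relabel_xx x); apply: relabel_le.
  by rewrite (dxx hd) (um_ge0 hd).
- exact: relabel_sym.
- move=> x y; split => [|->]; last exact: relabel_xx.
  apply: contra_eq => neq; rewrite gt_eqF // -(relabel_xx x) relabel_ltE.
  by rewrite (dxx hd) (d_gt0 hd).
- move=> x y z; rewrite le_max; have := um_max hd x y z; rewrite le_max.
  case/orP => [/relabel_le->//|le_d]; rewrite (relabel_sym x y) (relabel_sym z y).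
  by rewrite (@relabel_le y x z) ?orbT // (um_sym hd y x) (um_sym hd y z).
Qed.

Lemma relabel_nodes : nodes relabel = nodes d.
Proof.
apply/setP => B; apply/idP/idP.
  move/(node_cluster relabel_ultrametric hX) => [B0 clB].
  apply: cluster_node => //; split => // x y z xB yB zB.
  by rewrite -relabel_ltE; apply: clB.
move/(node_cluster hd hX) => [B0 clB].
apply: (cluster_node relabel_ultrametric) => //; split => // x y z xB yB zB.
by rewrite relabel_ltE; apply: clB.
Qed.

Lemma relabel_iso : rooted_iso (rep_tree d) (rep_tree relabel).
Proof.
have in_r (v : node d) : val v \in nodes relabel.
  by rewrite relabel_nodes; apply: valP.
have in_d (v : node relabel) : val v \in nodes d.
  by rewrite -relabel_nodes; apply: valP.
exists (fun v => to_node (in_r v)); split.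
- by exists (fun v => to_node (in_d v)) => v; apply: val_inj.
- have childE (u v : node d) :
      (val v \in children relabel (val u)) = (val v \in children d (val u)).
    rewrite (child_cover hd hX _ (valP u)).
    by rewrite (child_cover relabel_ultrametric hX _ (in_r u)) relabel_nodes.
  by move=> u v; rewrite /= !childE.
- exact: val_inj.
Qed.

End Relabelling.

(** * The number of distances as an invariant of weak similarity *)

Definition num_dist (R : realType) (X : finType) (d : X -> X -> R) : nat :=
  size (undup [seq d p.1 p.2 | p : X * X]).

Lemma weakly_similar_num_dist (R : realType) (X Y : finType)
    (d : X -> X -> R) (rho : Y -> Y -> R) :
  weakly_similar d rho -> num_dist d = num_dist rho.
Proof.
case=> Phi [[Psi PhiK PsiK] [f [[_ f_inj _] _ fE]]].
rewrite /num_dist; set s := [seq d _ _ | p : _].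
have s_inj : {in s &, injective f}.
  move=> _ _ /codomP[[x y] ->] /codomP[[z t] ->].
  apply: f_inj; apply/mem_set => /=.
    by exists x; [exact: in_setT|exists y; [exact: in_setT|]].
  by exists z; [exact: in_setT|exists t; [exact: in_setT|]].
rewrite -[LHS](size_map f); apply: perm_size; apply: uniq_perm.
- by rewrite map_inj_in_uniq ?undup_uniq // => u v; rewrite !mem_undup; apply: s_inj.
- exact: undup_uniq.
- move=> r; rewrite mem_undup; apply/mapP/codomP => [[t]|[[x y] ->]].
    by rewrite mem_undup => /codomP[[x y] ->] ->; exists (Phi x, Phi y); rewrite -fE.
  exists (d (Psi x) (Psi y)); last by rewrite fE !PsiK.
  by rewrite mem_undup; apply/codomP; exists (Psi x, Psi y).
Qed.

Lemma size_undup_codom_lt (T : finType) (A B : eqType) (r : T -> A) (s : T -> B) :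
  (forall p q, r p = r q -> s p = s q) ->
  (exists p q, r p != r q /\ s p = s q) ->
  (size (undup (codom s)) < size (undup (codom r)))%N.
Proof.
move=> rs [p [q [neq eqs]]].
pose g a := if [pick t | r t == a] is Some t then s t else s p.
have gE t : g (r t) = s t.
  by rewrite /g; case: pickP => [u /eqP/rs|/(_ t)]; rewrite ?eqxx.
have rp : r p \in undup (codom r) by rewrite mem_undup codom_f.
have rem_lt : (size (rem (r p) (undup (codom r))) < size (undup (codom r)))%N.
  by rewrite size_rem // prednK //; case: (undup _) rp.
apply: leq_ltn_trans rem_lt; rewrite -(size_map g).
apply: uniq_leq_size (undup_uniq _) _ => b; rewrite mem_undup => /codomP[t ->].
have [eqt|neqt] := eqVneq (r t) (r p).
  rewrite (rs _ _ eqt) eqs -gE map_f // (mem_rem_uniq _ (undup_uniq _)) inE /=.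
  by rewrite eq_sym neq mem_undup codom_f.
rewrite -gE map_f // (mem_rem_uniq _ (undup_uniq _)) inE /=.
by rewrite neqt mem_undup codom_f.
Qed.

(** * Two labellings with different numbers of distances *)

Section TwoRelabellings.
Variables (R : realType) (X : finType) (d : X -> X -> R).
Hypotheses (hd : is_ultrametric d) (hX : (0 < #|X|)%N).

(** Depth decreases as nodes grow, hence the subtraction; depths of nodes stay below [#|node d|], so
    it is never truncated there and the result is positive on larger nodes. *)
Definition depth_label (B : {set X}) : R :=
  if (#|B| <= 1)%N then 0 else (#|node d| - depth d B)%:R.

(* Digits in base #|{set X}|: the size makes the label monotone, the rank makes
   it injective. *)
Definition inj_label (B : {set X}) : R :=
  if (#|B| <= 1)%N then 0 else (#|B| * #|{set X}| + enum_rank B)%:R.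

Lemma depth_label_set1 x : depth_label [set x] = 0.
Proof. by rewrite /depth_label cards1. Qed.

Lemma inj_label_set1 x : inj_label [set x] = 0.
Proof. by rewrite /inj_label cards1. Qed.

Lemma proper_card_gt1 (B C : {set X}) :
  B \in nodes d -> B \proper C -> (1 < #|C|)%N.
Proof.
move=> /(node_cluster hd hX)[B0 _] /proper_card.
by apply: leq_trans; rewrite ltnS card_gt0.
Qed.

Lemma depth_label_mono B C : B \in nodes d -> C \in nodes d -> B \proper C ->
  depth_label B < depth_label C.
Proof.
move=> BN CN pBC; rewrite /depth_label (leqNgt #|C|) (proper_card_gt1 BN pBC) /=.
have ltC := depth_lt_card (to_node CN); rewrite /= in ltC.
case: ifP => _; first by rewrite ltr0n subn_gt0.
by rewrite ltr_nat ltn_sub2l // depth_proper.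
Qed.

Lemma inj_label_mono B C : B \in nodes d -> C \in nodes d -> B \proper C ->
  inj_label B < inj_label C.
Proof.
move=> BN CN pBC; rewrite /inj_label (leqNgt #|C|) (proper_card_gt1 BN pBC) /=.
have C_gt0 : (0 < #|C|)%N := ltnW (proper_card_gt1 BN pBC).
have ltM : (enum_rank B < #|{set X}|)%N := ltn_ord _.
case: ifP => _; last rewrite ltr_nat.
  by rewrite ltr0n addn_gt0 muln_gt0 C_gt0 (leq_ltn_trans _ ltM).
apply: leq_trans (leq_addr _ _).
apply: (@leq_trans (#|B|.+1 * #|{set X}|)); last first.
  by rewrite leq_mul2r proper_card ?orbT.
by rewrite mulSn addnC ltn_add2r.
Qed.

Lemma inj_label_inj (B C : {set X}) : (1 < #|B|)%N -> (1 < #|C|)%N ->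
  inj_label B = inj_label C -> B = C.
Proof.
rewrite /inj_label !ltnNge => /negbTE-> /negbTE-> /eqP; rewrite eqr_nat => /eqP.
(* Reduction modulo the base keeps only the rank digit. *)
move/(congr1 (modn^~ #|{set X}|)); rewrite !modnMDl !modn_small ?ltn_ord //.
by move/ord_inj/enum_rank_inj.
Qed.

Lemma ball_card_gt1 x y : x != y -> (1 < #|closed_ball d x (d x y)|)%N.
Proof.
by move=> neq; apply/card_gt1P; exists x, y; rewrite !(mem_ball hd).
Qed.

Lemma determined_by_tree_Rtilde :
  (forall (Y : finType) (rho : Y -> Y -> R),
      is_ultrametric rho -> (0 < #|Y|)%N ->
      rooted_iso (rep_tree d) (rep_tree rho) -> weakly_similar d rho) ->
  in_Rtilde d.
Proof.
move=> det; apply/(in_RtildeP hd hX) => u v.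
move=> /(inner_ballP hd hX)[x [y [nxy Eu]]] /(inner_ballP hd hX)[z [t [nzt Ev]]] duv.
apply/eqP/negP => /negP neq_uv.
pose r1 := relabel d inj_label; pose r2 := relabel d depth_label.
have um1 : is_ultrametric r1.
  exact: (relabel_ultrametric hd hX inj_label_set1 inj_label_mono).
have um2 : is_ultrametric r2.
  exact: (relabel_ultrametric hd hX depth_label_set1 depth_label_mono).
have E1 : num_dist d = num_dist r1.
  apply: weakly_similar_num_dist; apply: det => //.
  exact: (relabel_iso hd hX inj_label_set1 inj_label_mono).
have E2 : num_dist d = num_dist r2.
  apply: weakly_similar_num_dist; apply: det => //.
  exact: (relabel_iso hd hX depth_label_set1 depth_label_mono).
suff: (num_dist r2 < num_dist r1)%N by rewrite -E1 -E2 ltnn.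
(* A nonzero [r1] distance determines its ball, so [r2] is a function of [r1]. *)
have r1_ball a b a' b' : a != b -> r1 a b = r1 a' b' ->
    closed_ball d a (d a b) = closed_ball d a' (d a' b').
  move=> nab eqr; apply: inj_label_inj (eqr); apply: ball_card_gt1 => //.
  apply: contra_neq nab => eq_ab'; apply/(um_eq0 um1).
  by rewrite eqr eq_ab' (dxx um1).
apply: size_undup_codom_lt.
  move=> [a b] [a' b'] /= eqr; have [eq_ab|nab] := eqVneq a b.
    have /(um_eq0 um1) <- : r1 a' b' = 0 by rewrite -eqr eq_ab (dxx um1).
    by rewrite eq_ab !(dxx um2).
  by rewrite /r2 /relabel (r1_ball _ _ _ _ nab eqr).
(* These pairs span [u] and [v]: distinct balls, separated by [r1], but of equal depth, merged by
   [r2]. *)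
exists (x, y), (z, t); split => /=.
  apply: contra_neq neq_uv => /(r1_ball _ _ _ _ nxy) eq_ball.
  by apply: val_inj; rewrite Eu Ev.
rewrite /r2 /relabel /depth_label !(leqNgt _ 1) !ball_card_gt1 //=.
by rewrite -Eu -Ev duv.
Qed.

End TwoRelabellings.

Theorem theorem2p6 (R : realType) (X : finType) (d : X -> X -> R)
    (hd : is_ultrametric d) (hX : (0 < #|X|)%N) :
  (forall (Y : finType) (rho : Y -> Y -> R),
      is_ultrametric rho -> (0 < #|Y|)%N ->
      rooted_iso (rep_tree d) (rep_tree rho) -> weakly_similar d rho)
  <-> in_Rtilde d.
Proof.
split; first exact: determined_by_tree_Rtilde.
by move=> RX Y rho hrho hY; apply: Rtilde_weakly_similar.
Qed.
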